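(* Let $G$ be a locally compact, totally disconnected, second countable, unimodular group and let $(\Gamma_i)_{i\in\mathbb{N}}$ be a sequence of lattices in $G$. If $(\Gamma_i)_{i\in\mathbb{N}}$ is a Farber sequence, then the associated invariant random subgroups $\mu_{\Gamma_i}$ converge in $\operatorname{IRS}_G$ to the point measure $\delta_{\{e\}}$ on the trivial subgroup. Conversely, if $\mu_{\Gamma_i}\to\delta_{\{e\}}$ in $\operatorname{IRS}_G$ and the family $(\Gamma_i)_{i\in\mathbb{N}}$ is weakly uniformly discrete, then $(\Gamma_i)_{i\in\mathbb{N}}$ is a Farber sequence.
   Context: The set $\operatorname{Sub}_G$ of closed subgroups of $G$ carries the Chabauty topology, generated by the sets $O_1(C)=\{H\mid H\cap C=\emptyset\}$, $C\subset G$ compact, and $O_2(U)=\{H\mid H\cap U\neq\emptyset\}$, $U\subset G$ open. It is compact and metrisable, and $G$ acts continuously on it by conjugation. $\operatorname{IRS}_G$ is the space of $G$-invariant Borel probability measures on $\operatorname{Sub}_G$ with the topology of weak convergence. For a lattice $\Gamma<G$, $\mu_\Gamma\in\operatorname{IRS}_G$ is the push-forward of the invariant probability measure on $G/\Gamma$ under $g\Gamma\mapsto g\Gamma g^{-1}$. Statements about random conjugates of $\Gamma$ refer to $\mu_\Gamma$. $(\Gamma_i)$ is a Farber sequence if for every compact open subgroup $K<G$ and every right coset $C$ of $K$ the probability that a conjugate $g\Gamma_ig^{-1}$ meets $C\setminus\{e\}$ tends to $0$ as $i\to\infty$. A family $F$ of lattices of $G$ is weakly uniformly discrete if for every $\epsilon>0$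 there is a neighbourhood $U\subset G$ of the identity such that for every lattice in $F$ the probability that a conjugate of it intersects $U$ non-trivially (i.e. in more than $\{e\}$) is at most $\epsilon$. *)

(* Defs.v *)
From HB Require Import structures.
From mathcomp Require Import all_boot all_order all_algebra.
From mathcomp Require Import all_classical all_reals all_analysis.

Set Implicit Arguments.
Unset Strict Implicit.
Unset Printing Implicit Defensive.

Import numFieldNormedType.Exports.

Local Open Scope classical_set_scope.
Local Open Scope quotient_scope.
Local Open Scope ring_scope.

(* Topological groups are Hausdorff by convention. The base point is not
   related to the group structure; it is only there because
   g_sigma_algebraType needs a pointed type. *)
HB.mixin Record isTopGroup G & PointedTopological G & Group G := {
  mulg_continuous : continuous (fun xy : G * G => xy.1 * xy.2)%g ;
  invg_continuous : continuous (fun x : G => x^-1)%g ;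
  topGroup_hausdorff : hausdorff_space G }.

#[short(type="topGroupType")]
HB.structure Definition TopGroup :=
  {G of PointedTopological G & Group G & isTopGroup G}.

Definition borel (T : ptopologicalType) := g_sigma_algebraType (@open T).

Lemma continuous_measurable (S T : ptopologicalType) (f : S -> T) :
  continuous f -> measurable_fun [set: borel S] (f : borel S -> borel T).
Proof.
move=> /continuousP cf.
apply: (@measurability _ _ (borel S) (borel T) _ _ (@open T)) => //.
move=> _ [A oA <-]; rewrite setTI.
by apply: sub_sigma_algebra; exact: cf.
Qed.

Section haar.
Variables (R : realType) (G : topGroupType).
Implicit Type mu : {measure set (borel G) -> \bar R}.

Definition left_invariant mu := forall (g : G) (A : set (borel G)),
  measurable A -> mu ((fun x : G => g * x)%g @^-1` A) = mu A.

Definition right_invariant mu := forall (g : G) (A : set (borel G)),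
  measurable A -> mu ((fun x : G => x * g)%g @^-1` A) = mu A.

(* No regularity clause: on a second countable locally compact group a Borel
   measure that is finite on compact sets is automatically regular. *)
Definition left_haar mu :=
  [/\ left_invariant mu,
      forall K : set G, compact K -> (mu K < +oo)%E &
      mu [set: G] <> 0%E].

End haar.

Definition unimodular (R : realType) (G : topGroupType) :=
  exists2 mu : {measure set (borel G) -> \bar R},
    left_haar mu & right_invariant mu.

Definition is_subgroup (G : groupType) (H : set G) :=
  [/\ H 1%g, forall x y, H x -> H y -> H (x * y)%g &
      forall x, H x -> H (x^-1)%g].

Record closedSubgroup (G : topGroupType) := ClosedSubgroup {
  subgroup_set :> set G ;
  subgroup_closed : closed subgroup_set ;
  subgroupP : is_subgroup subgroup_set }.

Section closedSubgroup_theory.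
Variable G : topGroupType.
Local Notation SubG := (closedSubgroup G).
Implicit Types (H : SubG) (g : G).

Lemma closedSubgroup_eq H H' : (H : set G) = H' -> H = H'.
Proof.
case: H H' => [A cA sA] [B cB sB] /= AB; subst B.
by rewrite (Prop_irrelevance cA cB) (Prop_irrelevance sA sB).
Qed.

Lemma mulgl_continuous g : continuous (fun x : G => g * x)%g.
Proof.
move=> x; apply: (@continuous2_cvg _ _ _ _ _ _ (fun=> g) id (fun a b => a * b)%g).
- exact: (@mulg_continuous G (g, x)).
- exact: cvg_cst.
- exact: cvg_id.
Qed.

Lemma mulgr_continuous g : continuous (fun x : G => x * g)%g.
Proof.
move=> x; apply: (@continuous2_cvg _ _ _ _ _ _ id (fun=> g) (fun a b => a * b)%g).
- exact: (@mulg_continuous G (x, g)).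
- exact: cvg_id.
- exact: cvg_cst.
Qed.

Definition conj_set g (H : set G) : set G :=
  [set (g * h * g^-1)%g | h in H].

Lemma conj_setE g (H : set G) :
  conj_set g H = (fun x => g^-1 * x * g)%g @^-1` H.
Proof.
apply/seteqP; split => [_ [h Hh <-] /=|x /= Hx].
  by rewrite !mulgA mulVg mul1g -mulgA mulVg mulg1.
by exists (g^-1 * x * g)%g => //; rewrite !mulgA mulgV mul1g -mulgA mulgV mulg1.
Qed.

Lemma conj_set_closed g H : closed (conj_set g H).
Proof.
rewrite conj_setE; apply: (@closed_comp _ _ (fun x => g^-1 * x * g)%g).
  move=> x _.
  exact: (continuous_comp (@mulgl_continuous g^-1%g x) (@mulgr_continuous g _)).
exact: subgroup_closed.
Qed.

Lemma conj_set_subgroup g H : is_subgroup (conj_set g H).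
Proof.
have [H1 HM HV] := subgroupP H.
split=> [|_ _ [x Hx <-] [y Hy <-]|_ [x Hx <-]].
- by exists 1%g => //; rewrite mulg1 mulgV.
- exists (x * y)%g; first exact: HM.
  by rewrite !mulgA mulgVK.
- by exists (x^-1)%g; [exact: HV|rewrite !invgM invgK mulgA].
Qed.

Definition conj_subgroup g H : SubG :=
  ClosedSubgroup (@conj_set_closed g H) (@conj_set_subgroup g H).

Lemma trivial_closed : closed [set 1%g : G].
Proof.
by apply/accessible_closed_set1/hausdorff_accessible; exact: topGroup_hausdorff.
Qed.

Lemma trivial_subgroup : is_subgroup [set 1%g : G].
Proof.
by split=> // [x y -> ->|x ->]; rewrite ?mulg1 ?invg1.
Qed.

Definition trivialSubgroup : SubG :=
  ClosedSubgroup trivial_closed trivial_subgroup.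

Lemma conj_subgroup_trivial g :
  conj_subgroup g trivialSubgroup = trivialSubgroup.
Proof.
by apply: closedSubgroup_eq; rewrite /= /conj_set image_set1 mulg1 mulgV.
Qed.

Lemma conj_subgroupM g h H :
  conj_subgroup (g * h)%g H = conj_subgroup g (conj_subgroup h H).
Proof.
apply: closedSubgroup_eq => /=; rewrite !conj_setE.
by apply/funext => x; rewrite /preimage/= invgM !mulgA.
Qed.

HB.instance Definition _ := gen_eqMixin SubG.
HB.instance Definition _ := gen_choiceMixin SubG.
HB.instance Definition _ := isPointed.Build SubG trivialSubgroup.

Definition avoids (C : set G) : set SubG := [set H | H `&` C = set0].
Definition meets (U : set G) : set SubG := [set H | H `&` U !=set0].

Definition chabauty_subbase : set (set SubG) :=
  [set avoids C | C in compact] `|` [set meets U | U in open].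

HB.instance Definition _ :=
  isSubBaseTopological.Build SubG chabauty_subbase id.

Lemma chabauty_continuous (T : topologicalType) (f : T -> SubG) :
  (forall C, compact C -> open (f @^-1` avoids C)) ->
  (forall U, open U -> open (f @^-1` meets U)) -> continuous f.
Proof.
move=> fC fU; apply/continuousP => _ [D' sD' <-].
rewrite openE => x [B /[dup] D'B /sD' [E sE EB] Bfx].
suff : nbhs x (f @^-1` B) by apply: filterS => y By; exists B.
rewrite -EB preimage_bigcap; apply: filter_bigI => V EV.
have /set_mem Vsub := sE _ EV.
have oV : open (f @^-1` V).
  by case: Vsub => -[A hA <-]; [exact: fC|exact: fU].
apply: open_nbhs_nbhs; split => //.
by move: Bfx; rewrite -EB => /(_ V); exact.
Qed.

Lemma conj_subgroup_continuous H : continuous (conj_subgroup ^~ H).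
Proof.
apply: chabauty_continuous => [C cC|U oU]; rewrite openE => g.
  have cf : continuous (fun xg : G * G => xg.2^-1 * xg.1 * xg.2)%g.
    move=> xg; apply: (@continuous2_cvg _ _ _ _ _ _
      (fun xg : G * G => xg.2^-1 * xg.1)%g snd (fun a b => a * b)%g).
    - exact: (@mulg_continuous G (xg.2^-1 * xg.1, xg.2)%g).
    - apply: (@continuous2_cvg _ _ _ _ _ _
        (fun xg : G * G => xg.2^-1)%g fst (fun a b => a * b)%g).
      + exact: (@mulg_continuous G (xg.2^-1, xg.1)%g).
      + exact: (continuous_comp (@cvg_snd _ _ _ _ _) (@invg_continuous G _)).
      + exact: cvg_fst.
    - exact: cvg_snd.
  have avoidsE g' : avoids C (conj_subgroup g' H) <->
      C `<=` [set x | ~ subgroup_set H (g'^-1 * x * g')%g].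
    rewrite /avoids/= conj_setE; split=> [HC0 x Cx Hx|CH].
      by have : set0 x by rewrite -HC0.
    by apply/seteqP; split=> // x [Hx /CH].
  move=> /avoidsE Cg; move/compact_near_coveringP : cC => cC.
  suff : \forall g' \near g, C `<=` [set x | ~ subgroup_set H (g'^-1 * x * g')%g].
    by apply: filterS => g' Cg'; exact/avoidsE.
  apply: cC => x Cx.
  have : nbhs (g^-1 * x * g)%g (~` (H : set G)).
    apply: open_nbhs_nbhs; split; last exact: Cg.
    by rewrite openC; exact: subgroup_closed.
  by move=> /(cf (x, g)).
case=> _ [[h Hh <-] Uh].
have cf : continuous (fun x => x * h * x^-1)%g.
  move=> x; apply: (@continuous2_cvg _ _ _ _ _ _
    (fun x => x * h)%g (fun x => x^-1)%g (fun a b => a * b)%g).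
  - exact: (@mulg_continuous G (x * h, x^-1)%g).
  - exact: mulgr_continuous.
  - exact: invg_continuous.
suff : nbhs g [set x | U (x * h * x^-1)%g].
  apply: filterS => x Ux.
  by exists (x * h * x^-1)%g; split => //; exists h.
by apply: cf; exact: open_nbhs_nbhs.
Qed.

End closedSubgroup_theory.

Section coset_space.
Variables (G : topGroupType) (H : closedSubgroup G).
Implicit Types g x : G.

Definition lcoset_rel x y := `[< subgroup_set H (x^-1 * y)%g >].

Lemma lcoset_relP : equiv_class_of lcoset_rel.
Proof.
have [H1 HM HV] := subgroupP H; split=> [x|x y|y x z].
- by apply/asboolP; rewrite mulVg.
- by apply/asboolP/asboolP => /HV; rewrite invgM invgK.
- move=> /asboolP xy /asboolP yz; apply/asboolP.
  by have := HM _ _ xy yz; rewrite mulgA mulgK.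
Qed.

Definition lcoset_equiv := EquivRelPack lcoset_relP.

(* G / H, with the quotient topology *)
Definition coset_space := quotient_topology {eq_quot lcoset_equiv}.

Definition coset_act g (x : coset_space) : coset_space :=
  \pi_coset_space (g * repr x)%g.

Definition coset_conj (x : coset_space) : closedSubgroup G :=
  conj_subgroup (repr x) H.

Lemma lcoset_equivE x y :
  x = y %[mod coset_space] <-> subgroup_set H (x^-1 * y)%g.
Proof. by split=> [/eqmodP/asboolP|xy] //; apply/eqmodP/asboolP. Qed.

Lemma conj_subgroup_id x : subgroup_set H x -> conj_subgroup x H = H.
Proof.
have [H1 HM HV] := subgroupP H; move=> Hx.
apply: closedSubgroup_eq; rewrite /= conj_setE.
apply/seteqP; split=> y /= Hy; last first.
  by apply: (HM) => //; apply: HM => //; exact: HV.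
have := HM _ _ (HM _ _ Hx Hy) (HV _ Hx).
by rewrite !mulgA mulgV mul1g mulgK.
Qed.

Lemma coset_actE g x :
  coset_act g (\pi_coset_space x) = \pi_coset_space (g * x)%g.
Proof.
apply/lcoset_equivE; rewrite invgM mulgA mulgVK.
by apply/lcoset_equivE; rewrite reprK.
Qed.

Lemma coset_conjE x : coset_conj (\pi_coset_space x) = conj_subgroup x H.
Proof.
rewrite /coset_conj; set y := repr _.
have /conj_subgroup_id {2}<- : subgroup_set H (x^-1 * y)%g.
  by apply/lcoset_equivE; rewrite /y reprK.
by rewrite -conj_subgroupM mulgA mulgV mul1g.
Qed.

Lemma coset_conj_act g (x : coset_space) :
  coset_conj (coset_act g x) = conj_subgroup g (coset_conj x).
Proof. by rewrite -[x]reprK coset_actE !coset_conjE conj_subgroupM. Qed.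

Lemma coset_conj_continuous : continuous coset_conj.
Proof.
apply/quotient_continuous.
rewrite (_ : _ \o _ = @conj_subgroup G ^~ H); last by apply/funext/coset_conjE.
exact: conj_subgroup_continuous.
Qed.

Definition coset_conj_borel : borel coset_space -> borel (closedSubgroup G) :=
  coset_conj.

HB.instance Definition _ := isMeasurableFun.Build _ _ _ _ coset_conj_borel
  (continuous_measurable coset_conj_continuous).

End coset_space.

Section irs.
Variables (R : realType) (G : topGroupType).

Record irs := IRS {
  irs_prob :> probability (borel (closedSubgroup G)) R ;
  irs_invariant : forall (g : G) (A : set (borel (closedSubgroup G))),
    measurable A -> irs_prob (conj_subgroup g @^-1` A) = irs_prob A }.

HB.instance Definition _ := gen_eqMixin irs.
HB.instance Definition _ := gen_choiceMixin irs.

Record test_function := TestFunction {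
  test_fun :> closedSubgroup G -> R ;
  test_fun_continuous : continuous test_fun ;
  test_fun_bounded : exists M : R, forall H, `|test_fun H| <= M }.

Definition irs_integral (f : test_function) (mu : irs) : R :=
  \int[mu]_x f x.

(* the coarsest topology such that all integration maps are continuous *)
HB.instance Definition _ := Topological.copy irs
  (sup_topology (fun f : test_function =>
    Topological.class (initial_topology (irs_integral f)))).

Lemma cvg_irsP (F : set_system irs) (mu : irs) : Filter F ->
  F --> mu <->
  forall f : test_function, irs_integral f @ F --> irs_integral f mu.
Proof.
move=> FF; split=> [/cvg_sup Fmu f B Bmu|Fmu].
  apply: (Fmu f).
  exact: (@initial_continuous irs _ (irs_integral f) mu B Bmu).
apply/cvg_sup => f A /= [_ [[B oB <-] Bmu] BA].
by apply: filterS BA _; apply: Fmu; exact: open_nbhs_nbhs.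
Qed.

Definition dirac_trivial : probability (borel (closedSubgroup G)) R :=
  \d_(trivialSubgroup G : borel (closedSubgroup G)).

Lemma dirac_trivial_invariant (g : G) (A : set (borel (closedSubgroup G))) :
  measurable A -> dirac_trivial (conj_subgroup g @^-1` A) = dirac_trivial A.
Proof.
move=> _; rewrite /dirac_trivial /= !diracE; congr ((nat_of_bool _)%:R)%:E.
by apply/idP/idP; rewrite !inE /= conj_subgroup_trivial.
Qed.

Definition irs_trivial : irs := IRS dirac_trivial_invariant.

End irs.

Section lattice.
Variables (R : realType) (G : topGroupType).

(* Discrete subgroups of a Hausdorff group are closed, so that lattices may be
   taken among the closed subgroups. *)
Record lattice := Lattice {
  lattice_subgroup :> closedSubgroup G ;
  lattice_discrete : (lattice_subgroup : set G) `<=` isolated lattice_subgroup ;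
  lattice_covolume :
    exists nu : probability (borel (coset_space lattice_subgroup)) R,
      forall (g : G) (A : set (borel (coset_space lattice_subgroup))),
        measurable A -> nu (coset_act g @^-1` A) = nu A }.

Definition lattice_prob (L : lattice) :
    probability (borel (coset_space L)) R :=
  projT1 (cid (lattice_covolume L)).

Lemma lattice_prob_invariant (L : lattice) (g : G)
    (A : set (borel (coset_space L))) :
  measurable A -> lattice_prob L (coset_act g @^-1` A) = lattice_prob L A.
Proof. by rewrite /lattice_prob; case: cid => nu /= /(_ g A). Qed.

Definition lattice_irs_prob (L : lattice) :
    probability (borel (closedSubgroup G)) R :=
  distribution (lattice_prob L) (@coset_conj_borel G L).

Lemma lattice_irs_invariant (L : lattice) (g : G)
    (A : set (borel (closedSubgroup G))) : measurable A ->
  lattice_irs_prob L (conj_subgroup g @^-1` A) = lattice_irs_prob L A.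
Proof.
move=> mA; rewrite /lattice_irs_prob /distribution /= /pushforward /=.
rewrite -[RHS](lattice_prob_invariant g).
  congr (lattice_prob L _); apply/seteqP; split=> x /=;
  by rewrite /coset_conj_borel coset_conj_act.
rewrite -[X in measurable X]setTI.
exact: (measurable_funPT (@coset_conj_borel G L)).
Qed.

Definition lattice_irs (L : lattice) : irs R G :=
  IRS (@lattice_irs_invariant L).

Definition farber (L : nat -> lattice) :=
  forall K : set G, is_subgroup K -> open K -> compact K ->
  forall g : G,
    let C := [set (k * g)%g | k in K] in
    lattice_irs (L i) (meets (C `\ 1%g)) @[i --> \oo] --> 0%E.

(* Only open U are used, which makes the event below measurable; shrinking a
   neighbourhood makes the event smaller. *)
Definition weakly_uniformly_discrete (F : set lattice) :=
  forall eps : R, 0 < eps ->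
  exists2 U : set G, open_nbhs 1%g U &
    forall L, F L -> (lattice_irs L (meets (U `\ 1%g)) <= eps%:E)%E.

End lattice.

(* Main.v *)
Require Import Defs.
From mathcomp Require Import all_boot all_order all_algebra.
From mathcomp Require Import all_classical all_reals all_analysis.
From mathcomp Require Import measurable_realfun.
Import numFieldNormedType.Exports.
(* so that [meets] is the Chabauty set, not the relation between set systems *)
Import Defs.
Import Order.TTheory GRing.Theory Num.Theory.
Local Open Scope classical_set_scope.
Local Open Scope ring_scope.

(** Being close to the trivial subgroup in the Chabauty topology means avoiding a
    prescribed compact set that does not contain the identity
    ([trivial_chabauty_nbhs]). Consequently random subgroups converge weakly to
    the trivial one as soon as, for each such compact set, the probability of
    meeting it tends to [0] ([cvg_irs_trivial_of_meets]). The Farber condition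
    says this for cosets of compact open subgroups with the identity removed,
    and these cosets cover compact sets finitely, which gives the first
    implication.

    For the converse, a coset [C] of a compact open subgroup may contain the
    identity, and weak convergence says nothing about small nontrivial elements:
    this is where weak uniform discreteness enters. Given a small neighbourhood
    of the identity, choose a compact open set [V] inside it. Meeting [C] outside
    the identity means meeting [V] outside the identity, which has small
    probability uniformly in the lattice, or meeting [C `\` V]. The latter set is
    compact and open and does not contain the identity, so the subgroups
    meeting it form a clopen set, whose indicator function is a legitimate test
    function ([meets_clopen_cvg0]).

    Both directions need compact open sets. In a totally disconnected locally
    compact Hausdorff space they form a basis, because quasi-components of
    compact sets are connected ([quasicomponent_connected], [compact_open_nbhs]),
    and van Dantzig's argument turns them into compact open subgroups
    ([compact_open_subgroup]). *)

(** * Compact open neighbourhoods in totally disconnected spaces *)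

(** Otherwise the traces of the members of [F] on [E] generate a proper filter;
    by compactness it has a cluster point in [E], which belongs to every member
    of [F] because these are closed. *)
Lemma compact_disjoint_directed {T : topologicalType} (E : set T)
    (F : set_system T) :
  compact E -> F !=set0 -> setI_closed F -> (forall C, F C -> closed C) ->
  E `&` \bigcap_(C in F) C = set0 -> exists2 C, F C & E `&` C = set0.
Proof.
move=> cE [C0 FC0] FI Fcl E0; apply: contrapT => noC.
have meet C : F C -> E `&` C !=set0.
  by move=> FC; apply/set0P/eqP => EC0; apply: noC; exists C.
pose B := filter_from F (fun C => E `&` C).
have PB : ProperFilter B.
  apply: filter_from_proper => //; apply: filter_from_filter; first by exists C0.
  move=> C D FC FD; exists (C `&` D); first exact: FI.
  by move=> x [? []].
have [|p [Ep clp]] := cE B PB; first by exists C0 => // ? [].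
suff : set0 p by [].
rewrite -E0; split=> // C FC; apply: (Fcl C FC) => U Up.
by have [|y [[_ Cy] Uy]] := clp (E `&` C) U _ Up; [exists C|exists y].
Qed.

(** Tube argument: each point of [B] has a neighbourhood disjoint from some
    neighbourhood of [x], and compactness of [B] makes one neighbourhood of [x]
    work for all points of [B] simultaneously. *)
Lemma hausdorff_compact_point_separated {T : topologicalType} (x : T)
    (B : set T) : hausdorff_space T -> compact B -> ~ B x ->
  exists2 U, open_nbhs x U & closure U `&` B = set0.
Proof.
rewrite open_hausdorff => hT /compact_near_coveringP cB nBx.
have : \forall U \near powerset_filter_from (nbhs x), B `<=` ~` closure U.
  apply: cB => y By; have [|[V U]/= []] := hT y x.
    by apply: contra_notN nBx => /eqP <-.
  rewrite !inE => Vy Ux [oV oU VU0].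
  exists (V, [set W | W `<=` U]).
    split; first exact: open_nbhs_nbhs.
    apply/near_powerset_filter_fromP; first by move=> ? ?; exact: subset_trans.
    by exists U => //; exact: open_nbhs_nbhs.
  move=> [z W]/= [Vz WU] clWz.
  have [|t [Wt Vt]] := clWz V; first exact: open_nbhs_nbhs.
  by have : set0 t by rewrite -VU0; split => //; exact: WU.
move=> [/= R [RA _ [U RU]] /(_ U RU) BU].
have := RA U RU; rewrite nbhsE => -[W Wx WU]; exists W => //.
rewrite -subset0 => y [clWy /BU]; apply; exact: closureS clWy.
Qed.

(** The same tube argument once more, now shrinking a neighbourhood of all of
    [B] along the points of [A]. *)
Lemma hausdorff_compact_separated {T : topologicalType} (A B : set T) :
  hausdorff_space T -> compact A -> compact B -> A `&` B = set0 ->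
  exists U V, [/\ open U, open V, A `<=` U, B `<=` V & U `&` V = set0].
Proof.
move=> hT /compact_near_coveringP cA cB AB0.
have [->|/set0P B0] := eqVneq B set0.
  by exists setT, set0; split; rewrite ?setI0//; [exact: openT|exact: open0].
have PB : ProperFilter (set_nbhs B) by exact: set_nbhs_pfilter.
have : \forall V \near powerset_filter_from (set_nbhs B), A `<=` ~` closure V.
  apply: cA => x Ax.
  have [|U [oU Ux] UB0] := hausdorff_compact_point_separated x B hT cB.
    by move=> Bx; have : set0 x by rewrite -AB0.
  exists (U, [set W | W `<=` ~` closure U]).
    split; first exact: open_nbhs_nbhs.
    apply/near_powerset_filter_fromP; first by move=> ? ?; exact: subset_trans.
    exists (~` closure U) => //; apply/set_nbhsP; exists (~` closure U).
    split=> //; first exact/closed_openC/closed_closure.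
    by move=> y By clUy; have : set0 y by rewrite -UB0.
  move=> [z W]/= [Uz WU] clWz.
  have [|t [Wt Ut]] := clWz U; first exact: open_nbhs_nbhs.
  by apply: (WU _ Wt); exact: subset_closure.
move=> [/= R [RA _ [V RV]] /(_ V RV) AV].
have := RA V RV => /set_nbhsP[W [oW BW WV]].
exists (~` closure V), W; split => //.
  exact/closed_openC/closed_closure.
by rewrite -subset0 => y [clVy Wy]; apply: clVy; apply/subset_closure/WV.
Qed.

(** When [N] is closed these are the relatively clopen subsets of [N] that
    contain [x]: relative clopenness is expressed by two closed sets of the
    ambient space, so that no subspace topology is needed. *)
Definition clopen_pieces {T : topologicalType} (N : set T) (x : T) :=
  [set C : set T | [/\ C `<=` N, C x, closed C & closed (N `\` C)]].

Lemma clopen_pieces_setI {T : topologicalType} (N : set T) (x : T) :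
  setI_closed (clopen_pieces N x).
Proof.
move=> C D [CN Cx clC clC'] [DN Dx clD clD']; split.
- by move=> y [/CN].
- by split.
- exact: closedI.
- by rewrite setDIr; exact: closedU.
Qed.

(** In a compact Hausdorff space quasi-components are connected. If the
    quasi-component [Q] of [x] were the union of disjoint closed sets [A] and
    [B] with [x] in [A], separate them by disjoint open sets [U] and [V]. By
    compactness some clopen piece [C] lies in the union of [U] and [V]; then the
    intersection of [C] and [U] is again a clopen piece, so that [Q] lies in [U]
    and [B] is empty. *)
Lemma quasicomponent_connected {T : topologicalType} (N : set T) (x : T) :
  hausdorff_space T -> compact N -> N x ->
  connected (\bigcap_(C in clopen_pieces N x) C).
Proof.
move=> hT cN Nx; set P := clopen_pieces N x; set Q := \bigcap_(_ in _) _.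
have clN : closed N by exact: compact_closed.
have PN : P N by split => //; rewrite setDv; exact: closed0.
have PI : setI_closed P by exact: clopen_pieces_setI.
have QN : Q `<=` N by move=> y /(_ _ PN).
have Qx : Q x by move=> C [].
have clQ : closed Q by apply: closed_bigI => C [].
have no_split A B : closed A -> closed B -> Q = A `|` B -> A `&` B = set0 ->
    A x -> B = set0.
  move=> clA clB QAB AB0 Ax.
  have cA : compact A.
    by apply: (subclosed_compact clA cN) => y Ay; apply: QN; rewrite QAB; left.
  have cB : compact B.
    by apply: (subclosed_compact clB cN) => y By; apply: QN; rewrite QAB; right.
  have [U [V [oU oV AU BV UV0]]] :=
    hausdorff_compact_separated A B hT cA cB AB0.
  (* the part of N outside U and V misses Q, hence misses a single piece *)
  have [|||||C PC CUV] := compact_disjoint_directed (N `\` (U `|` V)) P.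
  - apply: (subclosed_compact _ cN); last by move=> y [].
    by apply: closedI => //; apply/open_closedC/openU.
  - by exists N.
  - exact: PI.
  - by move=> C [].
  - rewrite -subset0 => y [[_ nUV]] /=; rewrite -/(Q y) QAB => -[/AU|/BV] ?.
      by apply: nUV; left.
    by apply: nUV; right.
  have CE y : C y -> U y \/ V y.
    move=> Cy; apply: contrapT => nUV; have : set0 y; last by [].
    by rewrite -CUV; case: PC => CN _ _ _; split => //; split => //; exact: CN.
  have nUV y : U y -> V y -> False by move=> Uy Vy; have : set0 y by rewrite -UV0.
  case: PC => CN Cx clC clC'.
  have PCU : P (C `&` U).
    split.
    - by move=> y [/CN].
    - by split => //; exact: AU.
    (* inside C the open sets U and V are complementary *)
    - rewrite (_ : _ `&` _ = C `&` ~` V).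
        by apply: closedI => //; exact: open_closedC.
      apply/seteqP; split=> y [Cy]; first by move=> Uy; split => // /(nUV _ Uy).
      by case: (CE _ Cy).
    - rewrite setDIr; apply: closedU => //.
      by apply: closedI => //; exact: open_closedC.
  rewrite -subset0 => y By; apply: (nUV y); last exact: BV.
  have Qy : Q y by rewrite QAB; right.
  by case: (Qy _ PCU).
move=> B [b Bb] [U oU BU] [D clD BD].
have clB : closed B by rewrite BD; exact: closedI.
have clQB : closed (Q `&` ~` U) by apply: closedI => //; exact: open_closedC.
have QE : Q = B `|` (Q `&` ~` U) by rewrite BU -setIUr setUCr setIT.
have B0 : B `&` (Q `&` ~` U) = set0.
  by rewrite BU -subset0 => y [[_ ?] [_]].
have [Bx|nBx] := pselect (B x).
  by rewrite [RHS]QE (no_split _ _ clB clQB QE B0 Bx) setU0.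
suff B0' : B = set0 by rewrite B0' in Bb.
apply: (no_split _ _ clQB clB).
- by rewrite setUC.
- by rewrite setIC.
- by have [/nBx|] : (B `|` (Q `&` ~` U)) x by rewrite -QE.
Qed.

(** In a compact neighbourhood [N] of [x] the quasi-component of [x] is
    connected, hence it is the point [x]. So by compactness a clopen piece of
    [N] fits into the interior of the intersection of [N] and [W], and there
    relatively open means open. *)
Lemma compact_open_nbhs {T : topologicalType} (x : T) (W : set T) :
  hausdorff_space T -> locally_compact [set: T] ->
  totally_disconnected [set: T] -> nbhs x W ->
  exists V, [/\ compact V, open V, V x & V `<=` W].
Proof.
move=> hT lcT tdT Wx.
have [N wN [cN clN]] := lcT x I.
have {wN}Nx : nbhs x N by move: wN; rewrite /within/=; apply: filterS => y; exact.
pose P := clopen_pieces N x; pose Q := \bigcap_(C in P) C.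
have Q1 : Q `<=` [set x].
  rewrite -(tdT x I) => y Qy; exists Q => //; split => //; first by move=> C [].
  by apply: quasicomponent_connected => //; exact: nbhs_singleton.
pose O := (N `&` W)°.
have Ox : O x by exact: filterI.
have [|||||C PC C0] := compact_disjoint_directed (N `\` O) P.
- apply: (subclosed_compact _ cN); last by move=> y [].
  by apply: closedI => //; apply/open_closedC/open_interior.
- exists N; split => //; [exact: nbhs_singleton|rewrite setDv; exact: closed0].
- exact: clopen_pieces_setI.
- by move=> C [].
- by rewrite -subset0 => y [[_ nOy] /Q1]/= yx; apply: nOy; rewrite yx.
have CO : C `<=` O.
  case: PC => CN _ _ _ y Cy; apply: contrapT => nOy.
  have : set0 y by rewrite -C0; split => //; split => //; exact: CN.
  by [].
case: PC => CN Cx clC clC'; exists C; split => //.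
- exact: (subclosed_compact clC cN CN).
- rewrite (_ : C = O `&` ~` (N `\` C)).
    by apply: openI; [exact: open_interior|exact: closed_openC].
  apply/seteqP; split=> y; first by move=> Cy; split; [exact: CO|case].
  move=> [/interior_subset[Ny _] nNC]; apply: contrapT => nCy.
  by apply: nNC; split.
- by move=> y /CO/interior_subset[].
Qed.

(** * Compact open subgroups and their cosets *)

(** Van Dantzig: for a compact open neighbourhood [V] of the identity take the
    stabiliser of [V] under left translation. It is contained in [V] since the
    identity is in [V], open by the tube lemma because [V] is compact, and closed
    because [V] is. *)
Lemma compact_open_subgroup (G : topGroupType) (W : set G) :
  locally_compact [set: G] -> totally_disconnected [set: G] -> nbhs 1%g W ->
  exists K : set G, [/\ is_subgroup K, open K, compact K & K `<=` W].
Proof.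
move=> lcG tdG W1.
have [V [cV oV V1 VW]] := compact_open_nbhs _ _ (@topGroup_hausdorff G) lcG tdG W1.
have clV : closed V by apply: compact_closed => //; exact: topGroup_hausdorff.
pose S := [set x : G | V `<=` [set v | V (x * v)%g]].
have oS : open S.
  rewrite openE => x Sx; move/compact_near_coveringP : cV; apply => v Vv.
  have /(_ V) := @mulg_continuous G (x, v).
  case; first by apply: open_nbhs_nbhs; split => //; exact: Sx.
  by move=> [A B]/= [Ax Bv] ABV; exists (B, A) => // -[b a] [Bb Aa]; exact: (ABV (a, b)).
have clS : closed S.
  rewrite (_ : S = \bigcap_(v in V) (fun x : G => x * v)%g @^-1` V).
    apply: closed_bigI => v Vv; apply: preimage_closed => // x _.
    exact: mulgr_continuous.
  by apply/seteqP; split=> x Sx v /Sx.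
have SM x y : S x -> S y -> S (x * y)%g.
  by move=> Sx Sy v /Sy /Sx; rewrite /= mulgA.
pose K := S `&` (fun x : G => x^-1)%g @^-1` S.
have KV : K `<=` V by move=> x [/(_ _ V1)]/=; rewrite mulg1.
exists K; split.
- split=> [|x y [Sx Sx'] [Sy Sy']|x [Sx Sx']].
  + by split=> v Vv; rewrite /= ?invg1 mul1g.
  + by split; [exact: SM|rewrite /= invgM; exact: SM].
  + by split; rewrite /= ?invgK.
- apply: openI => //; apply: open_comp => // x _; exact: invg_continuous.
- apply: (subclosed_compact _ cV KV); apply: closedI => //.
  by apply: preimage_closed => // x _; exact: invg_continuous.
- exact: subset_trans KV VW.
Qed.

Lemma right_coset_open (G : topGroupType) (K : set G) (g : G) :
  open K -> open [set (k * g)%g | k in K].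
Proof.
move=> oK.
rewrite (_ : [set _ | _ in _] = (fun x : G => x * g^-1)%g @^-1` K).
  by apply: open_comp => // x _; exact: mulgr_continuous.
apply/seteqP; split=> [_ [k Kk <-]|x Kx] /=; first by rewrite mulgK.
by exists (x * g^-1)%g => //; rewrite mulgVK.
Qed.

Lemma right_coset_compact (G : topGroupType) (K : set G) (g : G) :
  compact K -> compact [set (k * g)%g | k in K].
Proof.
apply: continuous_compact; apply: continuous_subspaceT => x.
exact: mulgr_continuous.
Qed.

(** * The Chabauty topology near the trivial subgroup *)
Lemma open_chabauty_subbase (G : topGroupType) (A : set (closedSubgroup G)) :
  chabauty_subbase A -> open A.
Proof.
move=> sA; exists [set A]; last by rewrite bigcup_set1.
by move=> _ ->; exact: finI_from1.
Qed.

Lemma avoids_open (G : topGroupType) (C : set G) :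
  compact C -> open (avoids (G:=G) C).
Proof. by move=> cC; apply: open_chabauty_subbase; left; exists C. Qed.

Lemma meets_open (G : topGroupType) (U : set G) :
  open U -> open (meets (G:=G) U).
Proof. by move=> oU; apply: open_chabauty_subbase; right; exists U. Qed.

Lemma avoidsC (G : topGroupType) (C : set G) : ~` avoids C = meets (G:=G) C.
Proof.
by apply/seteqP; split=> H; [move=> /eqP/set0P|move=> /set0P/eqP].
Qed.

Lemma meets_closed (G : topGroupType) (C : set G) :
  compact C -> closed (meets (G:=G) C).
Proof. by move=> cC; rewrite -avoidsC; exact/open_closedC/avoids_open. Qed.

Lemma meetsS (G : topGroupType) (A B : set G) :
  A `<=` B -> meets (G:=G) A `<=` meets B.
Proof. by move=> AB H [x [Hx /AB Bx]]; exists x. Qed.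

Lemma meets_bigcup (G : topGroupType) I (D : set I) (A : I -> set G) :
  meets (G:=G) (\bigcup_(i in D) A i) = \bigcup_(i in D) meets (A i).
Proof.
apply/seteqP; split=> [H [x [Hx [i Di Aix]]]|H [i Di [x [Hx Aix]]]].
  by exists i => //; exists x.
by exists x; split => //; exists i.
Qed.

Lemma meetsU (G : topGroupType) (A B : set G) :
  meets (G:=G) (A `|` B) = meets A `|` meets B.
Proof.
apply/seteqP; split=> [H [x [Hx [Ax|Bx]]]|H [|] [x [Hx Ax]]].
- by left; exists x.
- by right; exists x.
- by exists x; split => //; left.
- by exists x; split => //; right.
Qed.

(** The sets of subgroups avoiding a given compact set away from the identity
    form a neighbourhood basis of the trivial subgroup: a condition of the form
    [meets U] satisfied by the trivial subgroup forces [U] to contain the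
    identity, so it holds for every subgroup, and finitely many conditions
    [avoids C] combine into one. *)
Lemma trivial_chabauty_nbhs (G : topGroupType) (B : set (closedSubgroup G)) :
  nbhs (trivialSubgroup G) B ->
  exists C : set G, [/\ compact C, ~ C 1%g & avoids C `<=` B].
Proof.
pose F := filter_from [set C : set G | compact C /\ ~ C 1%g] (@avoids G).
have FF : Filter F.
  apply: filter_from_filter; first by exists set0; split => //; exact: compact0.
  move=> C D [cC C1] [cD D1]; exists (C `|` D).
    by split; [exact: compactU|case].
  by move=> H; rewrite /avoids/= setIUr setU_eq0.
rewrite nbhsE => -[N [[D' sD' DN] N1] NB].
suff : F N by case=> C [cC C1] CN; exists C; split => //; exact: subset_trans NB.
move: N1; rewrite -DN => -[A D'A A1].
have [E sE EA] := sD' _ D'A.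
suff : F A by apply: filterS => H AH; exists A.
rewrite -EA; apply: filter_bigI => V EV.
have V1 : V (trivialSubgroup G) by move: A1; rewrite /= -EA; exact.
have /set_mem[[C cC CV]|[U oU UV]] := sE _ EV.
  exists C; last by rewrite CV.
  split=> // C1; move: V1; rewrite -CV /avoids/= => C0.
  by have : set0 (1%g : G) by rewrite -C0.
move: V1; rewrite -UV => -[x [/= -> U1]].
apply: (@filterS _ _ _ setT); last exact: filterT.
by move=> H _; exists 1%g; split => //; have [] := subgroupP H.
Qed.

(** * Integrals of test functions *)

Lemma open_borel {T : ptopologicalType} (A : set T) :
  open A -> measurable (A : set (borel T)).
Proof. exact: sub_sigma_algebra. Qed.

Lemma closed_borel {T : ptopologicalType} (A : set T) :
  closed A -> measurable (A : set (borel T)).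
Proof.
move=> clA; rewrite -[A]setCK; apply: measurableC; apply: open_borel.
exact: closed_openC.
Qed.

Section irs_facts.
Context {R : realType} {G : topGroupType}.
Implicit Types (mu : irs R G) (f : test_function R G).

Lemma test_function_measurable f :
  measurable_fun [set: borel (closedSubgroup G)] f.
Proof.
have /continuousP cf := @test_fun_continuous _ _ f.
apply: (measurability _ (RGenOpens.measurableE R)) => _ [_ [a [b ->] <-]].
rewrite setTI; apply: open_borel; apply: cf; exact: interval_open.
Qed.

Lemma irs_bounded_integrable mu (f : borel (closedSubgroup G) -> R) (M : R) :
  measurable_fun setT f -> (forall H, `|f H| <= M) ->
  mu.-integrable setT (EFin \o f).
Proof.
move=> mf fM; apply: measurable_bounded_integrable => //.
  by rewrite fin_num_fun_lty//; exact: fin_num_measure.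
exists M; split; rewrite ?num_real// => x Mx y _ /=.
exact: le_trans (fM y) (ltW Mx).
Qed.

Lemma irs_integral_trivial f :
  irs_integral f (irs_trivial R G) = f (trivialSubgroup G).
Proof.
rewrite /irs_integral /Rintegral /= /dirac_trivial integral_dirac//=.
  by rewrite /dirac indicT/= mul1r.
by apply/measurable_EFinP; exact: test_function_measurable.
Qed.

(** For a clopen [A], weak convergence tests the measure of [A] directly, with
    no approximation of its indicator function by continuous functions. *)
Lemma clopen_test_function (A : set (closedSubgroup G)) : open A -> closed A ->
  exists2 f : test_function R G, f =1 \1_A &
    forall mu, irs_integral f mu = fine (mu A).
Proof.
move=> oA clA.
have cA : continuous (\1_A : closedSubgroup G -> R).
  move=> H; apply: (@cvg_near_cst _ _ _ _ (nbhs H) _).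
  have [AH|nAH] := pselect (A H).
    have : nbhs H A by apply: open_nbhs_nbhs.
    by apply: filterS => K AK; rewrite !indicE !mem_set.
  have : nbhs H (~` A) by apply: open_nbhs_nbhs; split => //; exact: closed_openC.
  by apply: filterS => K AK; rewrite !indicE !memNset.
have bA : exists M : R, forall H, `|\1_A H : R| <= M.
  by exists 1 => H; rewrite indicE; case: (_ \in _); rewrite ?normr1 ?normr0.
exists (TestFunction cA bA) => // mu.
rewrite /irs_integral /Rintegral/= integral_indic ?setIT//.
exact: open_borel.
Qed.

(** In absolute value the integrand [f H - f K] is at most [e] off [A] and at
    most [2 * M] on [A]. *)
Lemma dist_irs_integral mu f (A : set (closedSubgroup G)) (H : closedSubgroup G)
    (M e : R) : measurable (A : set (borel (closedSubgroup G))) ->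
  0 <= e -> (forall K, `|f K| <= M) -> (forall K, ~ A K -> `|f H - f K| <= e) ->
  `|f H - irs_integral f mu| <= e + 2 * M * fine (mu A).
Proof.
move=> mA e0 fM fA.
have M0 : 0 <= M by exact: le_trans (fM H).
have mf := test_function_measurable f.
have mi : measurable_fun [set: borel (closedSubgroup G)] (\1_A : _ -> R).
  exact: measurable_indic.
have if_ : mu.-integrable setT (EFin \o f) by exact: irs_bounded_integrable mf fM.
have ic (c : R) : mu.-integrable setT (EFin \o (fun=> c)).
  by apply: (irs_bounded_integrable mu _ `|c|).
have ii : mu.-integrable setT (EFin \o \1_A).
  by apply: (irs_bounded_integrable mu _ 1) => // K;
    rewrite indicE; case: (_ \in _); rewrite ?normr1 ?normr0.
have cst (c : R) : \int[mu]_x c = c.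
  by rewrite Rintegral_cst// [X in fine X](@probability_setT _ _ _ mu) mulr1.
have -> : f H - irs_integral f mu = \int[mu]_x (f H - f x).
  by rewrite RintegralB// cst.
have iB : mu.-integrable setT (EFin \o (fun x => f H - f x)).
  by apply: (irs_bounded_integrable mu _ (M + M)) => [|K];
    [exact: measurable_funB|rewrite (le_trans (ler_normB _ _))// lerD].
have iZ : mu.-integrable setT (EFin \o (fun x => 2 * M * \1_A x)).
  apply: (irs_bounded_integrable mu _ (2 * M)) => [|K].
    exact: measurable_funM.
  rewrite normrM ger0_norm ?mulr_ge0// ler_piMr ?mulr_ge0//.
  by rewrite indicE; case: (_ \in _); rewrite ?normr1 ?normr0.
have -> : e + 2 * M * fine (mu A) = \int[mu]_x (e + 2 * M * \1_A x).
  rewrite RintegralD// cst RintegralZl// /Rintegral integral_indic//.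
  by rewrite setIT.
apply: le_trans (le_normr_Rintegral _ _) _ => //.
apply: le_Rintegral => //.
- apply: (irs_bounded_integrable mu _ (M + M)) => [|K].
    by apply: measurableT_comp => //; exact: measurable_funB.
  by rewrite normr_id (le_trans (ler_normB _ _))// lerD.
- apply: (irs_bounded_integrable mu _ (e + 2 * M)) => [|K].
    by apply: measurable_funD => //; exact: measurable_funM.
  rewrite ger0_norm; last by rewrite addr_ge0 ?mulr_ge0.
  by rewrite lerD2l ler_piMr ?mulr_ge0.
move=> K _; have [AK|nAK] := pselect (A K).
  rewrite indicE mem_set// mulr1 (le_trans (ler_normB _ _))// mulr_natl.
  by rewrite (le_trans (lerD (fM _) (fM _)))// -mulr2n lerDr.
by rewrite indicE memNset// mulr0 addr0; exact: fA.
Qed.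

End irs_facts.

(** * Events of vanishing probability *)
Section vanishing.
Context {R : realType} {d} {X : measurableType d} {T : Type} {F : set_system T}
  {FF : Filter F}.
Variable mu : T -> probability X R.

(** Nonnegativity reduces convergence to [0] to eventual upper bounds, the form
    in which the bounds of uniform discreteness and of unions combine. *)
Lemma probability_cvg0P (A : set X) : measurable A ->
  mu t A @[t --> F] --> 0%E <->
  forall e : R, 0 < e -> \forall t \near F, (mu t A <= e%:E)%E.
Proof.
move=> mA; have fin t : mu t A \is a fin_num by exact: fin_num_measure.
split=> [/fine_cvgP[_ /cvgrPdist_le A0] e e0|A0].
  have := A0 _ e0; apply: filterS => t.
  rewrite sub0r normrN ger0_norm ?fine_ge0// => Ae.
  by rewrite -[mu t A]fineK.
apply/fine_cvgP; split; first exact: nearW.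
apply/cvgrPdist_le => e /A0; apply: filterS => t Ae.
by rewrite sub0r normrN ger0_norm ?fine_ge0// -lee_fin fineK.
Qed.

Lemma probability_cvg0_sub (A B : set X) : measurable A -> measurable B ->
  A `<=` B -> mu t B @[t --> F] --> 0%E -> mu t A @[t --> F] --> 0%E.
Proof.
move=> mA mB AB /(probability_cvg0P _ mB) B0.
apply/probability_cvg0P => // e /B0.
by apply: filterS => t; apply: le_trans; apply: le_measure; rewrite ?inE.
Qed.

Lemma probability_cvg0_bigsetU (I : Type) (s : seq I) (A : I -> set X) :
  (forall i, measurable (A i)) ->
  (forall i, mu t (A i) @[t --> F] --> 0%E) ->
  mu t (\big[setU/set0]_(i <- s) A i) @[t --> F] --> 0%E.
Proof.
move=> mA A0; elim: s => [|i s IHs].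
  rewrite big_nil; under eq_fun do rewrite measure0; exact: cvg_cst.
have mS : measurable (\big[setU/set0]_(i <- s) A i).
  exact: bigsetU_measurable.
rewrite big_cons; apply/probability_cvg0P; first exact: measurableU.
move=> e e0.
have e20 : 0 < e / 2 by rewrite divr_gt0.
have S0 := (probability_cvg0P _ mS).1 IHs _ e20.
have Ai0 := (probability_cvg0P _ (mA i)).1 (A0 i) _ e20.
apply: filterS2 S0 Ai0 => t St Ait.
by rewrite (le_trans (measureU2 _ _ _))// (splitr e) EFinD leeD.
Qed.

End vanishing.

(** * Convergence to the trivial subgroup *)

Lemma meets_compact_borel {G : topGroupType} (C : set G) :
  compact C -> measurable (meets C : set (borel (closedSubgroup G))).
Proof. by move=> cC; apply: closed_borel; exact: meets_closed. Qed.

Lemma meets_open_borel {G : topGroupType} (U : set G) :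
  open U -> measurable (meets U : set (borel (closedSubgroup G))).
Proof. by move=> oU; apply: open_borel; exact: meets_open. Qed.

Lemma open_setD1 {G : topGroupType} (U : set G) : open U -> open (U `\ 1%g).
Proof. by move=> oU; apply: openI => //; exact/closed_openC/trivial_closed. Qed.

Section convergence.
Context {R : realType} {G : topGroupType} {T : Type} {F : set_system T}
  {FF : Filter F}.
Variable mu : T -> irs R G.

(** A test function is nearly constant on the subgroups avoiding some compact
    [C] that does not contain the identity, and it is bounded on the remaining
    ones, whose probability tends to [0]. *)
Lemma cvg_irs_trivial_of_meets :
  (forall C : set G, compact C -> ~ C 1%g ->
     mu t (meets C) @[t --> F] --> 0%E) ->
  mu t @[t --> F] --> irs_trivial R G.
Proof.
move=> mu0; apply/cvg_irsP => f; rewrite irs_integral_trivial.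
apply/cvgrPdist_le => e e0; rewrite near_map; have [M fM] := @test_fun_bounded _ _ f.
have e20 : 0 < e / 2 by rewrite divr_gt0.
(* the bound is enlarged to be nonzero, as it is divided by below *)
have M1 : 0 < `|M| + 1 by rewrite ltr_wpDl.
have : nbhs (trivialSubgroup G)
    [set H | `|f (trivialSubgroup G) - f H| <= e / 2].
  by have /cvgrPdist_le/(_ _ e20) := @test_fun_continuous _ _ f (trivialSubgroup G).
move=> /trivial_chabauty_nbhs[C [cC C1 Cf]].
have mC := meets_compact_borel C cC.
have d0 : 0 < e / 2 / (2 * (`|M| + 1)) by rewrite divr_gt0// mulr_gt0.
have /(_ FF _ d0) := (probability_cvg0P _ _ mC).1 (mu0 C cC C1).
apply: filterS => t muC.
apply: le_trans (dist_irs_integral (mu t) f _ _ (`|M| + 1) _ mC (ltW e20) _ _) _.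
- by move=> K; rewrite (le_trans (fM K))// (le_trans (ler_norm _))// lerDl.
- by move=> K; rewrite -avoidsC => /contrapT/Cf.
rewrite [leRHS]splitr lerD2l mulrC -ler_pdivlMr; last by rewrite mulr_gt0.
by rewrite -lee_fin fineK//; exact: fin_num_measure.
Qed.

(** For [C] both compact and open, [meets C] is clopen in the Chabauty topology,
    so its indicator function is a test function; it vanishes at the trivial
    subgroup. *)
Lemma meets_clopen_cvg0 (C : set G) :
  mu t @[t --> F] --> irs_trivial R G -> open C -> compact C -> ~ C 1%g ->
  mu t (meets C) @[t --> F] --> 0%E.
Proof.
move=> mu_triv oC cC C1.
have [f fE If] := clopen_test_function (R:=R) _ (meets_open _ C oC) (meets_closed _ C cC).
apply/fine_cvgP; split.
  by apply: nearW => t; apply: fin_num_measure; exact: meets_compact_borel.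
move/cvg_irsP : mu_triv => /(_ f); rewrite irs_integral_trivial fE indicE.
rewrite memNset; last by case=> x [/= -> /C1].
by apply: cvg_trans; apply: near_eq_cvg; apply: nearW => t; rewrite /= If.
Qed.

End convergence.

(** Finitely many right cosets of one compact open subgroup cover a compact set
    [C] that does not contain the identity. The cosets may contain the identity,
    but removing it from them loses nothing of [C]. *)
Lemma farber_cvg_irs_trivial {R : realType} {G : topGroupType}
    (Gamma : nat -> lattice R G) :
  locally_compact [set: G] -> totally_disconnected [set: G] ->
  farber Gamma -> lattice_irs (Gamma i) @[i --> \oo] --> irs_trivial R G.
Proof.
move=> lcG tdG farberG; apply: cvg_irs_trivial_of_meets => C cC C1.
have [K [sK oK cK _]] := compact_open_subgroup G setT lcG tdG filterT.
pose Kg (g : G) : set G := [set (k * g)%g | k in K].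
have [D _ CD] : finite_subset_cover C Kg C.
  move: cC; rewrite compact_cover; apply=> [g _|g Cg].
    exact: right_coset_open.
  by exists g => //; exists 1%g; [case: sK|rewrite mul1g].
have mKg g : measurable
    (meets (Kg g `\ 1%g) : set (borel (closedSubgroup G))).
  by apply: meets_open_borel; apply: open_setD1; exact: right_coset_open.
apply: (@probability_cvg0_sub _ _ _ _ _ _ (fun i => irs_prob (lattice_irs (Gamma i)))
  _ (\big[setU/set0]_(g <- finmap.enum_fset D) meets (Kg g `\ 1%g))).
- exact: meets_compact_borel.
- exact: bigsetU_measurable.
- rewrite -bigcup_fset -meets_bigcup; apply: meetsS => x Cx.
  have [g Dg Kgx] := CD x Cx; exists g => //; split => // x1.
  by apply: C1; rewrite -x1.
- apply: (probability_cvg0_bigsetU (fun i => irs_prob (lattice_irs (Gamma i)))) => // g.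
  exact: farberG.
Qed.

(** Weak uniform discreteness bounds the probability of meeting a compact open [V]
    around the identity nontrivially; the rest of the coset, [C `\` V], is compact
    and open, so that weak convergence controls it. *)
Lemma cvg_irs_trivial_farber {R : realType} {G : topGroupType}
    (Gamma : nat -> lattice R G) :
  locally_compact [set: G] -> totally_disconnected [set: G] ->
  lattice_irs (Gamma i) @[i --> \oo] --> irs_trivial R G ->
  weakly_uniformly_discrete (range Gamma) -> farber Gamma.
Proof.
move=> lcG tdG mu_triv wud K sK oK cK g /=; set C := [set _ | _ in _].
have oC : open C by exact: right_coset_open.
have cC : compact C by exact: right_coset_compact.
have mC1 := meets_open_borel _ (open_setD1 _ oC).
apply/(probability_cvg0P (fun i => irs_prob (lattice_irs (Gamma i)))) => // e e0.
have e20 : 0 < e / 2 by rewrite divr_gt0.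
have [U [oU U1] muU] := wud _ e20.
have [V [cV oV V1 VU]] := compact_open_nbhs 1%g U (@topGroup_hausdorff G) lcG tdG
  (open_nbhs_nbhs (conj oU U1)).
have clV : closed V by apply: compact_closed => //; exact: topGroup_hausdorff.
have oCV : open (C `\` V) by apply: openI => //; exact: closed_openC.
have cCV : compact (C `\` V).
  apply: (subclosed_compact _ cC); last by move=> x [].
  apply: closedI; last exact: open_closedC.
  by apply: compact_closed => //; exact: topGroup_hausdorff.
have CV1 : ~ (C `\` V) 1%g by case.
have mCV := meets_open_borel _ oCV.
have mU1 := meets_open_borel _ (open_setD1 _ oU).
have CV0 : lattice_irs (Gamma i) (meets (C `\` V)) @[i --> \oo] --> 0%E.
  exact: meets_clopen_cvg0.
move/(probability_cvg0P (fun i => irs_prob (lattice_irs (Gamma i)))) : CV0.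
move=> /(_ mCV _ e20).
apply: filterS => i muCV.
have C1_sub : meets (C `\ 1%g) `<=` meets (U `\ 1%g) `|` meets (C `\` V).
  rewrite -meetsU; apply: meetsS => x [Cx x1].
  by have [/VU Ux|nVx] := pselect (V x); [left|right].
have mUCV := measurableU _ _ mU1 mCV.
pose m := irs_prob (lattice_irs (Gamma i)).
apply: (@le_trans _ _ (m (meets (U `\ 1%g) `|` meets (C `\` V)))).
  by apply: le_measure; rewrite ?inE.
apply: (le_trans (measureU2 m mU1 mCV)).
by rewrite (splitr e) EFinD leeD//; apply: muU; exists i.
Qed.

Theorem proposition1p4 (R : realType) (G : topGroupType)
    (G_locally_compact : locally_compact [set: G])
    (G_totally_disconnected : totally_disconnected [set: G])
    (G_second_countable : @second_countable G)
    (G_unimodular : unimodular R G)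
    (Gamma : nat -> lattice R G) :
  (farber Gamma ->
     lattice_irs (Gamma i) @[i --> \oo] --> irs_trivial R G) /\
  (lattice_irs (Gamma i) @[i --> \oo] --> irs_trivial R G ->
     weakly_uniformly_discrete (range Gamma) ->
     farber Gamma).
Proof.
split; first exact: farber_cvg_irs_trivial.
exact: cvg_irs_trivial_farber.
Qed.
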